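(* Let $L$ be an oriented non-split alternating link with consolidated Tait graphs $G_B^*$, $G_W^*$ and weighted adjacency matrices $\overline A_B$, $\overline A_W$, and let $X_B$, $X_W$ be diagonal matrices of independent commuting vertex variables of the corresponding sizes. For every $k\ge3$, $$CWR_k(L)=\frac12\Bigl([t^k]\,\operatorname{sq}\bigl(-\log\det(I-tX_B\overline A_B)\bigr),\;[t^k]\,\operatorname{sq}\bigl(-\log\det(I-tX_W\overline A_W)\bigr)\Bigr).$$ Moreover the pair of polynomials $\operatorname{sq}(-\log\det(I-tX_B\overline A_B))$ and $\operatorname{sq}(-\log\det(I-tX_W\overline A_W))$ determines the whole invariant $CWR(L)$: the components with $k\ge3$ are given by the displayed formula, and $CWR_2(L)$ is recovered from the two coefficients of $t^2$, which are polynomials in $w^2$ and $r^2$, by the substitution $w^2\mapsto w$, $r^2\mapsto r$.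
   Context: Tait graphs and $CWR$. Let $D$ be a reduced (no nugatory crossings) alternating diagram of an oriented non-split alternating link $L$. The regions of $D$ are checkerboard coloured black and white, so that regions sharing an edge have opposite colours; which class is called black is fixed once and for all by a local rule depending on the over/under pattern at crossings, the same rule for all diagrams (the statement holds for either choice of rule). The Tait graph $G_B$ has one vertex for each black region and one edge for each crossing, joining the black regions meeting at that crossing; $G_W$ is defined in the same way from white regions. Each edge $e$ gets weight $\operatorname{wg}(e)=w$ if the crossing is positive and $r$ if it is negative, where $w,r$ are commuting indeterminates. The consolidated Tait graph $G_B^*$ is the weighted simple graph obtained from $G_B$ by replacing all parallel edges joining the same pair of vertices by a single edge whose weight is the product of their weights; $G_W^*$ is obtained from $G_W$ likewise. For $i>2$, $CB_i(w,r)=\sum_C\prod_{e\in E(C)}\operatorname{wg}(e)$, summed over all unoriented simple cycles $C$ of length $i$ in $G_B^*$; $CB_2(w,r)=\sum_{e\in E(G_B^* )}\operatorname{wg}(e)$; $CW_i$ is defined analogously from $G_W^*$; $CWR_i=(CB_i,CW_i)$ for $i\ge2$; and $CWR=(CWR_2,CWR_3,\ldots)$ with trailing pairs $(0,0)$ omitted. It is a known theorem that $CWR$ does not depend on the chosen reduced alternating diagram $D$ of $L$; $CWR(L)$ and $CWR_i(L)$ denote the common values. The weighted adjacency matrix of a simple loopless weighted graph has $(i,j)$ entry equal to the weight of the edge $v_iv_j$ if it exists, and $0$ otherwise. The logarithm is the formal one, $\log(1+u)=\sum_{j\ge1}(-1)^{j+1}u^j/j$, applied to $\det(I-tX\overline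 A)\in 1+t\,\mathbb{Z}[w,r][x_1,\dots,x_n][t]$. For $P=\sum_\alpha c_\alpha x^\alpha\in\mathbb{Q}[w,r][x_1,\ldots,x_n]$, $\operatorname{sq}(P)=\sum_{\alpha\in\{0,1\}^n}c_\alpha$ is the sum of the coefficients of the squarefree monomials, extended coefficientwise to power series in $t$. $[t^k]$ denotes the coefficient of $t^k$. *)

(* Defs.v *)
From HB Require Import structures.
From Stdlib Require Import Relation_Operators.
From mathcomp Require Import all_boot all_order all_algebra.
From mathcomp Require Import mpoly.

Set Implicit Arguments.
Unset Strict Implicit.
Unset Printing Implicit Defensive.

Import GRing.Theory.

(* Oriented link diagrams, up to isotopy of the sphere, as combinatorial maps.
   The dart (c, i) is the i-th of the four half-edges at the crossing c, listed
   counterclockwise from the incoming half of the under-strand: 0 and 2 are the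
   two halves of the under-strand, 1 and 3 those of the over-strand.
   [opp] exchanges the two ends of each edge of the diagram. *)
Definition step (T : Type) (d : T * 'I_4) : T * 'I_4 := (d.1, ordS d.2).
Definition step_back (T : Type) (d : T * 'I_4) : T * 'I_4 := (d.1, ord_pred d.2).
Definition straight (T : Type) (d : T * 'I_4) : T * 'I_4 := step (step d).

Definition over (T : Type) (d : T * 'I_4) : bool := odd d.2.

(* A crossing is positive iff its over-strand runs from half-edge 3 to
   half-edge 1, so that turning it counterclockwise to the under-strand through
   the smaller angle matches the orientations. *)
Definition outgoing (T : Type) (pos : T -> bool) (d : T * 'I_4) : bool :=
  (nat_of_ord d.2 == 2) || (nat_of_ord d.2 == if pos d.1 then 1 else 3).

(* (c, i) also names the corner at c between the half-edges i and i+1.  Leaving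
   c along the half-edge i with this corner on the left, one comes to the next
   corner of the same region. *)
Definition next_corner (T : Type) (opp : T * 'I_4 -> T * 'I_4)
  (d : T * 'I_4) : T * 'I_4 := step_back (opp d).

Definition adjacent (T : eqType) (opp : T * 'I_4 -> T * 'I_4) : rel T :=
  fun c c' => [exists i : 'I_4, (opp (c, i)).1 == c'].

(* [planar] is Euler's formula summed over the connected components of the
   underlying 4-valent graph, which has twice as many edges as vertices.  The
   relative position of the components is not recorded: it does not affect the
   link. *)
Record diagram := Diagram {
  crossing : finType;
  positive : crossing -> bool;
  opp : crossing * 'I_4 -> crossing * 'I_4;
  circles : nat; (* number of components without crossings *)
  oppK : involutive opp;
  outgoing_opp : forall d, outgoing positive (opp d) = ~~ outgoing positive d;
  planar : fcard (next_corner opp) predT =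
           #|crossing| + 2 * n_comp (adjacent opp) predT }.

Definition dart (D : diagram) : finType := (crossing D * 'I_4)%type.
Definition corner (D : diagram) : finType := dart D.
Definition next (D : diagram) : corner D -> corner D := next_corner (@opp D).

Definition connected (D : diagram) : Prop :=
  n_comp (adjacent (@opp D)) predT + circles D = 1.

(* Along every edge one goes from an over-crossing to an under-crossing. *)
Definition alternating (D : diagram) : Prop :=
  forall d : dart D, over (opp d) = ~~ over d.

(* A crossing is nugatory if two opposite corners at it lie in the same region,
   i.e. if some simple closed curve crosses the diagram at that crossing only. *)
Definition nugatory (D : diagram) (c : crossing D) : Prop :=
  exists i : 'I_4, fconnect (@next D) (c, i) (straight (c, i)).

Definition reduced (D : diagram) : Prop := forall c : crossing D, ~ nugatory c.

(* Links are taken as classes of diagrams modulo Reidemeister moves. *)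

(* The continuation of one's way along the dart d, if crossings in K are passed
   straight on. *)
Definition pass (D : diagram) (K : {set crossing D}) (d : dart D) : dart D :=
  if d.1 \in K then opp (straight d) else d.

(* The components of D all of whose crossings are in K; each of them is one
   orbit of incoming darts under following the strand. *)
Definition components_in (D : diagram) (K : {set crossing D}) : nat :=
  let strand := fun d : dart D => opp (straight d) in
  fcard strand [pred d : dart D | ~~ outgoing (@positive D) d &
                                  all (fun x => x.1 \in K) (orbit strand d)].

(* D' is D with the crossings in K deleted and the strands through them
   disentangled, up to renaming crossings; D' is D up to renaming when K is
   empty. *)
Definition deletion (D : diagram) (K : {set crossing D}) (D' : diagram) : Prop :=
  exists f : crossing D' -> crossing D,
    let F (d : dart D') : dart D := (f d.1, d.2) in
    [/\ injective f,
        f @: [set: crossing D'] = ~: K,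
        forall c, positive (f c) = positive c,
        forall d, F (opp d) = iter #|dart D| (pass K) (opp (F d))
      & circles D' = circles D + components_in K].

Definition renaming (D D' : diagram) : Prop := deletion (set0 : {set crossing D}) D'.

Definition reidemeister1 (D D' : diagram) : Prop :=
  exists d : corner D, next d = d /\ deletion [set d.1] D'.

(* A two-sided region with one strand over the other. *)
Definition reidemeister2 (D D' : diagram) : Prop :=
  exists d e : corner D,
    [/\ d.1 != e.1, next d = e, next e = d, over (opp d) = over d
      & deletion [set d.1; e.1] D'].

(* Moving one side of a triangular region T across the opposite crossing.  The
   two crossings on a side change places; in terms of darts, each strand through
   two crossings of T meets them in the order

     outside -- (x, crossing, x') -- (y', crossing, y) -- outside

   before the move, and afterwards the attachments of x and y', and of x' and y,
   are interchanged. *)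
Definition slide (D : diagram) (T : {set corner D}) (x : dart D) : dart D :=
  if x.1 \in [set d.1 | d in T] then
    if (x \in T) || (step_back x \in T) then straight (opp x)
    else opp (straight x)
  else x.

(* The side of T along d is over at both of its crossings. *)
Definition reidemeister3 (D D' : diagram) : Prop :=
  exists d : corner D,
    let T := [set x in orbit (@next D) d] in
    [/\ #|T| = 3, #|[set x.1 | x in T]| = 3, over d, over (opp d)
      & exists f : crossing D' -> crossing D,
        let F (x : dart D') : dart D := (f x.1, x.2) in
        [/\ bijective f,
            forall c, positive (f c) = positive c,
            forall x, F (opp x) = slide T (opp (slide T (F x)))
          & circles D' = circles D]].

Definition reidemeister (D D' : diagram) : Prop :=
  [\/ renaming D D', reidemeister1 D D', reidemeister2 D D' | reidemeister3 D D'].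

Definition isotopic : diagram -> diagram -> Prop :=
  clos_refl_sym_trans diagram reidemeister.

Record link := Link {
  diagram_of :> diagram -> Prop;
  diagram_ofP : exists D0, forall D, diagram_of D <-> isotopic D0 D }.

Definition nonsplit (L : link) : Prop := forall D, L D -> connected D.

Definition alternating_link (L : link) : Prop := exists2 D, L D & alternating D.

Definition reduced_alternating_diagram (L : link) (D : diagram) : Prop :=
  [/\ L D, reduced D & alternating D].

Local Open Scope ring_scope.

(* Weighted graphs.  Z[w, r] is viewed inside Q[w, r]. *)
Notation wrpoly := {mpoly rat[2]}.
Definition w : wrpoly := 'X_0.
Definition r : wrpoly := 'X_1.

Record multigraph := Multigraph {
  mvertex : finType;
  medge : finType;
  mends : medge -> {set mvertex};
  mwg : medge -> wrpoly }.

Record graph := Graph {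
  vertex : finType;
  edges : {set {set vertex}};
  wg : {set vertex} -> wrpoly }.

Definition consolidate (G : multigraph) : graph :=
  @Graph (mvertex G) [set mends e | e : medge G]
         (fun p => \prod_(e | mends e == p) mwg e).

(* An unoriented simple cycle, as the set of its edges. *)
Definition is_cycle (G : graph) (i : nat) (C : {set {set vertex G}}) : bool :=
  [exists s : i.-tuple (vertex G),
     ucycleb (fun x y => [set x; y] \in edges G) s &&
     (C == [set [set x; path.next s x] | x in s])].

Definition cycle_poly (G : graph) (i : nat) : wrpoly :=
  if i == 2%N then \sum_(e in edges G) wg e
  else \sum_(C : {set {set vertex G}} | is_cycle i C) \prod_(e in C) wg e.

Definition adjacency (G : graph) : 'M[wrpoly]_#|vertex G| :=
  \matrix_(i, j)
    let e := [set enum_val i; enum_val j] in if e \in edges G then wg e else 0.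

(* Regions and Tait graphs. *)
Definition is_region (D : diagram) (R : {set corner D}) : bool :=
  [exists d, R == [set x in orbit (@next D) d]].

(* The regions coloured by the local rule that singles out, for b = true, the
   corners swept by the over-strand when it is turned counterclockwise up to the
   under-strand, and for b = false the other corners. *)
Definition coloured (D : diagram) (b : bool) (R : {set corner D}) : bool :=
  is_region R && [forall d in R, odd d.2 == b].

Lemma odd_ordS (i : 'I_4) : odd (ordS i) = ~~ odd i.
Proof. by case: i => [[|[|[|[|]]]]]. Qed.

Lemma odd_ord_pred (i : 'I_4) : odd (ord_pred i) = ~~ odd i.
Proof. by case: i => [[|[|[|[|]]]]]. Qed.

(* In an alternating diagram the rule is a checkerboard colouring: each region
   gets one colour, and the regions on the two sides of an edge, namely those of
   the corners d and [step_back d], get different ones. *)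
Lemma colouredP (D : diagram) (b : bool) (d : corner D) : alternating D ->
  coloured b [set x in orbit (@next D) d] = (odd d.2 == b).
Proof.
move=> altD; rewrite /coloured.
have -> /= : is_region [set x in orbit (@next D) d] by apply/existsP; exists d.
have nextE (x : corner D) : odd (next x).2 = odd x.2.
  by rewrite odd_ord_pred; have := altD x; rewrite /over => ->; rewrite negbK.
apply/forall_inP/idP => [/(_ d)|db x]; first by rewrite inE -fconnect_orbit connect0; apply.
rewrite inE -fconnect_orbit => /iter_findex <-.
by elim: findex => //= n; rewrite nextE.
Qed.

Lemma checkerboard (D : diagram) (b : bool) (d : corner D) : alternating D ->
  coloured b [set x in orbit (@next D) (step_back d)] =
  ~~ coloured b [set x in orbit (@next D) d].
Proof.
by move=> altD; rewrite !colouredP // odd_ord_pred; case: odd; case: b.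
Qed.

(* A connected diagram contains a crossingless circle only if it is that circle;
   it has then two regions, one of each colour, which have no corners. *)
Definition tait_vertex (D : diagram) (b : bool) : finType :=
  ({R : {set corner D} | coloured b R} + 'I_(circles D))%type.

Definition tait_ends (D : diagram) (b : bool) (c : crossing D) :
    {set tait_vertex D b} :=
  [set v : tait_vertex D b |
     if v is inl R then [exists i : 'I_4, (c, i) \in val R] else false].

Definition tait (D : diagram) (b : bool) : multigraph :=
  @Multigraph (tait_vertex D b) (crossing D) (@tait_ends D b)
              (fun c => if positive c then w else r).

(* G_B^* and G_W^*; [rule] is the choice of which colour is called black. *)
Definition GB (rule : bool) (D : diagram) : graph := consolidate (tait D rule).
Definition GW (rule : bool) (D : diagram) : graph := consolidate (tait D (~~ rule)).

Definition CWR_coef (rule : bool) (D : diagram) (i : nat) : wrpoly * wrpoly :=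
  (cycle_poly (GB rule D) i, cycle_poly (GW rule D) i).

Definition omit_trailing (T : eqType) (z : T) (s : seq T) : seq T :=
  let s' := rev s in rev (drop (find (predC1 z) s') s').

(* There are no cycles longer than the number of vertices. *)
Definition CWR (rule : bool) (D : diagram) : seq (wrpoly * wrpoly) :=
  omit_trailing (0, 0)
    [seq CWR_coef rule D i
       | i <- iota 2 (#|vertex (GB rule D)| + #|vertex (GW rule D)|)%N].

(* Power series in t are given by their coefficients. *)
Section LogDet.
Variable n : nat.
Local Notation S := {mpoly wrpoly[n]}.

(* [t^k] log(1 + u) for u divisible by t: the terms with j > k vanish. *)
Definition log1p_coef (u : {poly S}) (k : nat) : S :=
  \sum_(1 <= j < k.+1)
    (((-1) ^+ j.+1 / j%:R : rat)%:MP : wrpoly) *: (u ^+ j)`_k.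

(* det(I - t X A), with 'X playing the role of t. *)
Definition char_series (A : 'M[wrpoly]_n) : {poly S} :=
  let X : 'M[S]_n := diag_mx (\row_i 'X_i) in
  let XA : 'M[S]_n := X *m map_mx (@mpolyC n _) A in
  \det (1%:M - 'X *: map_mx polyC XA).

Definition sq (P : S) : wrpoly :=
  \sum_(m <- msupp P | [forall i, (m i <= 1)%N]) P@_m.

(* [t^k] sq(- log det(I - t X A)) *)
Definition sq_log_det (A : 'M[wrpoly]_n) (k : nat) : wrpoly :=
  sq (- log1p_coef (char_series A - 1) k).

End LogDet.

Definition sqB (rule : bool) (D : diagram) (k : nat) : wrpoly :=
  sq_log_det (adjacency (GB rule D)) k.
Definition sqW (rule : bool) (D : diagram) (k : nat) : wrpoly :=
  sq_log_det (adjacency (GW rule D)) k.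

(* The polynomial P(w^2, r^2). *)
Definition in_squares (P : wrpoly) : wrpoly := P \mPo [tuple w ^+ 2; r ^+ 2].

(* Main.v *)
Require Import Defs.
From mathcomp Require Import all_boot all_order all_algebra.
From mathcomp Require Import perm mpoly ring.

Set Implicit Arguments.
Unset Strict Implicit.
Unset Printing Implicit Defensive.

Import GRing.Theory Num.Theory.
Local Open Scope ring_scope.

(* By Jacobi's formula, [t^k] (- log det (I - t M)) = tr (M^k) / k.  For M = X A
   this is 1/k times a sum over closed walks of length k, in which a walk carries
   the monomial of the vertices that it visits; the squarefree monomials are those
   of the walks without repeated vertices.  For k >= 3 a simple cycle of length k
   is run through by exactly 2k of these (a starting point and a direction).  For
   k = 2 they go back and forth along one edge, so that each edge contributes the
   square of its weight.  A loop would count in CWR_2 but not in the coefficient of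
   t^2; the Tait graphs of a reduced diagram have none. *)

(** * The logarithm of a characteristic series *)

Lemma deriv_prod (R : comNzRingType) (n : nat) (F : 'I_n -> {poly R}) :
  (\prod_i F i)^`() = \sum_i (F i)^`() * \prod_(j | j != i) F j.
Proof.
elim: n F => [|n IH] F; first by rewrite !big_ord0 derivC.
rewrite big_ord_recl derivM IH mulr_sumr [RHS]big_ord_recl; congr (_ * _ + _).
  rewrite [RHS]big_mkcond /= big_ord_recl eqxx mul1r.
  by apply: eq_bigr => i _.
apply: eq_bigr => i _; rewrite mulrCA; congr (_ * _).
rewrite [RHS]big_mkcond big_ord_recl /=; congr (_ * _).
rewrite big_mkcond; apply: eq_bigr => j _.
by rewrite (inj_eq (@lift_inj _ _)).
Qed.

(** Jacobi's formula. The Leibniz expansion is differentiated one row at a time, and each resulting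
    determinant is expanded along its differentiated row. *)
Lemma deriv_det (R : comNzRingType) (n : nat) (Q : 'M[{poly R}]_n) :
  (\det Q)^`() = \tr (\adj Q *m map_mx (@deriv R) Q).
Proof.
have -> : (\det Q)^`() = \sum_i \det (\matrix_(k, j)
    if k == i then (Q k j)^`() else Q k j).
  rewrite exchange_big raddf_sum; apply: eq_bigr => s _ /=.
  have derivS (b : bool) (q : {poly R}) : ((-1) ^+ b * q)^`() = (-1) ^+ b * q^`().
    by case: b; rewrite ?expr1 ?expr0 ?mulN1r ?mul1r ?derivN.
  rewrite derivS deriv_prod mulr_sumr; apply: eq_bigr => i _.
  congr (_ * _); rewrite [RHS](bigD1 i) //= mxE eqxx; congr (_ * _).
  by apply: eq_bigr => j /negPf ji; rewrite mxE ji.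
rewrite mxtrace_mulC; apply: eq_bigr => i _.
rewrite (expand_det_row _ i) mxE; apply: eq_bigr => j _.
rewrite !mxE eqxx; congr (_ * (_ * \det _)).
by apply/matrixP => k l; rewrite !mxE eq_sym (negPf (neq_lift _ _)).
Qed.

(* Write p = det (1 - t M), L for the truncation of log p and T for the generating
   series of the tr (M^(i+1)).  Then p L' = p' and, by Jacobi's formula,
   p T = - p', both modulo 'X^k, and p is invertible modulo 'X^k with inverse S. *)
Lemma log_det_coef (R : comNzRingType) (n : nat) (M : 'M[R]_n) (k : nat)
    (a : nat -> R) :
  (0 < k)%N -> (forall j, (0 < j)%N -> j%:R * a j = (-1) ^+ j.+1) ->
  let u := \det (1%:M - 'X *: map_mx polyC M) - 1 in
  k%:R * (\sum_(1 <= j < k.+1) a j *: u ^+ j)`_k = - \tr (M ^+ k).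
Proof.
case: k => // k _ ha u.
set p := \det (1%:M - 'X *: map_mx polyC M) in u *.
set L := \sum_(_ <= _ < _) _.
have u0 : u`_0 = 0.
  rewrite -horner_coef0 /u hornerD hornerN hornerC -[_.[0]]/(horner_eval 0 p).
  rewrite -det_map_mx map_mxB map_mx1 map_mxZ /= /horner_eval hornerX.
  by rewrite scale0r subr0 det1 subrr.
have [q uX] : exists q, u = 'X * q.
  have /factor_theorem[q] : root u 0 by rewrite rootE horner_coef0 u0.
  by rewrite subr0 mulrC; exists q.
set S := \sum_(i < k.+1) (- u) ^+ i.
(* A geometric sum in [- u]: as ['X] divides [u], the remainder is a multiple of ['X^(k.+1)]. After
   the case split, [k] is one less than in the statement. *)
have pS : p * S = 1 - 'X^(k.+1) * (- q) ^+ k.+1.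
  rewrite -exprMn mulrN -uX -opprB subrX1 -mulNr; congr (_ * _).
  by rewrite opprB opprK addrC /u subrK.
(* By [ha], each term of L differentiates to p' times a power of [- u], so that L' is exactly p'
   times the same geometric sum. *)
have dL : L^`() = p^`() * S.
  rewrite /L big_add1 big_mkord raddf_sum mulr_sumr; apply: eq_bigr => i _ /=.
  rewrite derivZ deriv_exp -[_ *+ _]scaler_nat scalerA mulrC ha //.
  rewrite scalerAr; congr (_ * _); first by rewrite /u derivB derivC subr0.
  by rewrite -mul_polyC rmorphXn rmorphN1 !exprS !mulN1r opprK [RHS]exprNn.
pose T : {poly R} := \poly_(i < k.+1) \tr (M ^+ i.+1).
pose M' := map_mx polyC M.
pose G := \sum_(i < k.+1) 'X^i *: M' ^+ i.
have TE : T = \tr (G *m M').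
  rewrite mulmx_suml raddf_sum /T poly_def; apply: eq_bigr => i _ /=.
  rewrite -scalemxAl mxtraceZ -mul_polyC mulrC; congr (_ * _).
  by rewrite -[_ *m _]exprSr -rmorphXn -trace_map_mx.
set Q := 1%:M - 'X *: M' in p u L u0 uX S pS dL *.
have QG : Q *m G = 1%:M - 'X^(k.+1) *: M' ^+ k.+1.
  rewrite /G; elim: k.+1 => [|m IH].
    by rewrite big_ord0 mulmx0 !expr0 scale1r subrr.
  rewrite big_ord_recr /= mulmxDr {}IH [in X in _ + X]mulmxBl mul1mx.
  rewrite -scalemxAl -scalemxAr scalerA -exprS -[_ *m _]exprS.
  by rewrite addrA subrK.
have dQ : map_mx (@deriv R) Q = - M'.
  apply/matrixP => i j; rewrite !mxE derivB derivM derivX derivC mulr0 addr0 mul1r.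
  by case: (_ == _); rewrite ?mulr0n derivC sub0r.
pose e := \tr (\adj Q *m M' ^+ k.+1 *m M').
have pT : p * T = - p^`() - 'X^(k.+1) * e.
  (* The scalar matrix of [p] is written as [\adj Q *m Q], and its factor [Q] is absorbed by [G]
     through [QG]. *)
  rewrite TE -mxtraceZ -mul_scalar_mx -mul_adj_mx -mulmxA (mulmxA Q) QG.
  rewrite /p deriv_det dQ mulmxN linearN opprK mulmxBl mul1mx mulmxBr linearB /=.
  by rewrite -scalemxAl -scalemxAr linearZ /= mulmxA.
have [h uT] : exists h, L^`() + T = 'X^(k.+1) * h.
  set t := (- q) ^+ k.+1 in pS.
  (* The witness comes from multiplying L' + T by 1, written as [p * S + 'X^(k.+1) * t]. In p S (L'
     + T), the terms p' and - p' supplied by [dL], [pS] and [pT] cancel, and all that remains has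
     the factor ['X^(k.+1)]. *)
  exists (t * (L^`() + T) - S * (p^`() * t + e)).
  transitivity ((p * S) * (L^`() + T) + 'X^(k.+1) * t * (L^`() + T)).
    by rewrite pS; ring.
  rewrite {1}dL; transitivity (S * (p^`() * (p * S) + p * T) +
    'X^(k.+1) * t * (L^`() + T)).
    by ring.
  by rewrite pS pT; ring.
(* The coefficient of ['X^k] is [k.+1] times that of ['X^(k.+1)] in L on one side, the trace of
   [M ^+ k.+1] on the other. *)
have /eqP := congr1 (coefp k) uT.
rewrite /= coefD coef_deriv coefXnM ltnSn coef_poly ltnSn.
by rewrite addr_eq0 mulr_natl => /eqP.
Qed.

(** * Traces of powers and their squarefree part *)

Fixpoint path_prod (T : Type) (R : pzSemiRingType) (f : T -> T -> R) (x : T)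
    (s : seq T) : R :=
  if s is y :: s' then f x y * path_prod f y s' else 1.

(** The weight of the closed walk through [s]. The value 1 on the empty sequence spares the formulas
    below a case distinction. *)
Definition cycle_prod (T : Type) (R : pzSemiRingType) (f : T -> T -> R)
    (s : seq T) : R :=
  if s is x :: s' then path_prod f x (rcons s' x) else 1.

Lemma big_tuple_cons (R : nmodType) (T : finType) (n : nat) (F : seq T -> R) :
  \sum_(s : n.+1.-tuple T) F s = \sum_x \sum_(s : n.-tuple T) F (x :: s).
Proof.
rewrite pair_big_dep /=.
rewrite (reindex (fun p : T * n.-tuple T => [tuple of p.1 :: p.2])) //=.
by exists (fun s => (thead s, [tuple of behead s])) => [[x s]|s] _;
  [congr (_, _); apply: val_inj | rewrite -tuple_eta].
Qed.

(** The tuple lists the inner vertices of a walk, one fewer than its steps. *)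
Lemma expmx_coef (R : pzSemiRingType) (n m : nat) (M : 'M[R]_n) (x y : 'I_n) :
  (M ^+ m.+1) x y = \sum_(s : m.-tuple 'I_n) path_prod (fun i j => M i j) x (rcons s y).
Proof.
elim: m x => [|m IH] x.
  by rewrite (big_pred1 [tuple]) /= ?mulr1 // => s; apply/esym/eqP/tuple0.
rewrite exprS mxE (big_tuple_cons m (fun s => path_prod _ x (rcons s y))).
by apply: eq_bigr => z _; rewrite IH mulr_sumr.
Qed.

Lemma mxtrace_exp (R : pzSemiRingType) (n m : nat) (M : 'M[R]_n) :
  \tr (M ^+ m.+1) = \sum_(s : m.+1.-tuple 'I_n) cycle_prod (fun i j => M i j) s.
Proof.
rewrite (big_tuple_cons m (cycle_prod _)).
by apply: eq_bigr => x _; rewrite expmx_coef.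
Qed.

Lemma cycle_prod_next (T : eqType) (R : comPzSemiRingType) (f : T -> T -> R) (s : seq T) :
  uniq s -> cycle_prod f s = \prod_(z <- s) f z (path.next s z).
Proof.
case: s => [|x s]; first by rewrite big_nil.
rewrite /cycle_prod /path.next.
(* Only the current vertex is generalised, to [y]; the vertex [x] at which the walk closes stays
   fixed. *)
elim: s {1 2 4 6}x => [|z s IH] y /=.
  by rewrite big_seq1 eqxx mulr1.
move=> /andP[yzs uzs]; rewrite big_cons eqxx (IH z) //; congr (_ * _).
apply: eq_big_seq => t ts; case: eqP => // ty.
by rewrite -ty ts in yzs.
Qed.

(** Each visit to a vertex starts exactly one step. For the matrix X A this separates the monomial
    of the visited vertices from the weight of the walk. *)
Lemma cycle_prodM (T : eqType) (R : comPzSemiRingType) (g : T -> R) (f : T -> T -> R)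
    (s : seq T) :
  cycle_prod (fun x y => g x * f x y) s = (\prod_(z <- s) g z) * cycle_prod f s.
Proof.
case: s => [|x s]; first by rewrite big_nil mulr1.
rewrite /cycle_prod; elim: s {1 3 4}x => [|y s IH] z /=.
  by rewrite big_seq1 mulrA.
by rewrite IH [in RHS]big_cons mulrACA.
Qed.

Lemma rmorph_cycle_prod (T : Type) (R S : pzSemiRingType) (h : {rmorphism R -> S})
    (f : T -> T -> R) (s : seq T) :
  cycle_prod (fun x y => h (f x y)) s = h (cycle_prod f s).
Proof.
case: s => [|x s]; rewrite /cycle_prod ?rmorph1 //.
elim: (rcons s x) {1 3}x => [|y t IH] z /=; first by rewrite rmorph1.
by rewrite IH rmorphM.
Qed.

Lemma eq_cycle_prod (T : Type) (R : pzSemiRingType) (f g : T -> T -> R) (s : seq T) :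
  f =2 g -> cycle_prod f s = cycle_prod g s.
Proof.
move=> fg; case: s => [|x s] //; rewrite /cycle_prod.
by elim: (rcons s x) {1 3}x => [|y t IH] z //=; rewrite fg IH.
Qed.

Section Squarefree.
Variables (n : nat) (R : nzRingType).
Implicit Types (m : 'X_{1..n}) (P Q : {mpoly R[n]}).

Definition squarefree m : bool := [forall i, (m i <= 1)%N].

Definition mnm_of_subset (f : {ffun 'I_n -> bool}) : 'X_{1..n} :=
  [multinom nat_of_bool (f i) | i < n].

Lemma mnm_of_subset_inj : injective mnm_of_subset.
Proof.
move=> f1 f2 /mnmP e; apply/ffunP => i.
by have := e i; rewrite !mnmE; case: (f1 i); case: (f2 i).
Qed.

Lemma squarefreeP m : reflect (exists f, m = mnm_of_subset f) (squarefree m).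
Proof.
apply: (iffP forallP) => [sm|[f ->] i]; last by rewrite mnmE; case: (f i).
exists [ffun i => m i == 1%N]; apply/mnmP => i; rewrite mnmE ffunE.
by have := sm i; case: (m i) => [|[]].
Qed.

(** The range of summation becomes independent of [P], which makes the additivity of [sq] visible;
    indices outside the support contribute 0. *)
Lemma sum_squarefree P :
  \sum_(m <- msupp P | squarefree m) P@_m = \sum_f P@_(mnm_of_subset f).
Proof.
rewrite -(big_map mnm_of_subset xpredT (fun m => P@_m)).
rewrite [RHS](bigID (mem (msupp P))) /= [X in _ + X]big1 ?addr0 => [|m mP]; last first.
  exact: memN_msupp_eq0.
rewrite -[LHS]big_filter -[RHS]big_filter; apply/perm_big/uniq_perm.
- exact/filter_uniq/msupp_uniq.
- by rewrite filter_uniq // map_inj_uniq ?index_enum_uniq //; apply: mnm_of_subset_inj.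
move=> m; rewrite !mem_filter andbC; congr (_ && _).
apply/squarefreeP/mapP => [[f ->]|[f _ ->]]; last by exists f.
by exists f; first exact: mem_index_enum.
Qed.
End Squarefree.

Section Sq.
Variable n : nat.
Implicit Types (P Q : {mpoly wrpoly[n]}).

Lemma sqE P : sq P = \sum_f P@_(mnm_of_subset f).
Proof. exact: sum_squarefree. Qed.

Lemma sqMn (k : nat) P : sq (P *+ k) = sq P *+ k.
Proof. rewrite !sqE -sumrMnl; apply: eq_bigr => f _; exact: mcoeffMn. Qed.

Lemma sq_sum (I : finType) (F : I -> {mpoly wrpoly[n]}) :
  sq (\sum_i F i) = \sum_i sq (F i).
Proof.
rewrite sqE; transitivity (\sum_i \sum_f (F i)@_(mnm_of_subset f)).
  by rewrite exchange_big; apply: eq_bigr => f _; apply: raddf_sum.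
by apply: eq_bigr => i _; rewrite sqE.
Qed.

Lemma sqZX (c : wrpoly) (m : 'X_{1..n}) :
  sq (c *: 'X_[m]) = if squarefree m then c else 0.
Proof.
have mE f : (c *: 'X_[m])@_(mnm_of_subset f) = if m == mnm_of_subset f then c else 0.
  by rewrite mcoeffZ mcoeffX; case: (_ == _); rewrite ?mulr1 ?mulr0.
rewrite sqE (eq_bigr _ (fun f _ => mE f)) -big_mkcond.
case: (squarefreeP m) => [[f ->]|Nm].
  by rewrite (big_pred1 f) // => g; rewrite /= (inj_eq (@mnm_of_subset_inj n)) eq_sym.
by rewrite big_pred0 // => f; apply/eqP => e; apply: Nm; exists f.
Qed.
End Sq.

Section SqLogDet.
Variables (n : nat) (A : 'M[wrpoly]_n).

Lemma log1p_coef_det (M : 'M[{mpoly wrpoly[n]}]_n) (k : nat) : (0 < k)%N ->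
  k%:R * log1p_coef (\det (1%:M - 'X *: map_mx polyC M) - 1) k = - \tr (M ^+ k).
Proof.
move=> k0; pose b j : rat := (-1) ^+ j.+1 / j%:R.
pose a j : {mpoly wrpoly[n]} := ((b j)%:MP)%:MP.
have ha j : (0 < j)%N -> j%:R * a j = (-1) ^+ j.+1.
  move=> j0; rewrite /a -2!mpolyC_nat -!rmorphM /b mulrC divfK ?pnatr_eq0 -?lt0n //.
  by rewrite !rmorphXn !rmorphN1.
rewrite -(log_det_coef M k0 ha) /log1p_coef coef_sum; congr (_ * _).
by apply: eq_bigr => j _; rewrite coefZ -mul_mpolyC.
Qed.

(** The exponent of the variable [i] is the number of occurrences of [i] in [s]. *)
Lemma squarefree_sum_seq (s : seq 'I_n) :
  squarefree (\sum_(z <- s) U_(z))%MM = uniq s.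
Proof.
have cE i : (\sum_(z <- s) U_(z))%MM i = count_mem i s.
  rewrite mnm_sumE -sum1_count [RHS]big_mkcond /=.
  by apply: eq_bigr => z _; rewrite mnm1E; case: (_ == _).
apply/forallP/idP => [h|us i]; last by rewrite cE count_uniq_mem // leq_b1.
apply/count_mem_uniq => i; have := h i; rewrite cE -has_pred1 has_count.
by case: (count_mem i s) => [|[]].
Qed.

Lemma sq_log_det_tuples (k : nat) : (0 < k)%N ->
  sq_log_det A k *+ k = \sum_(s : k.-tuple 'I_n | uniq s) cycle_prod (fun i j => A i j) s.
Proof.
case: k => // k _; rewrite /sq_log_det -sqMn mulNrn -mulr_natl log1p_coef_det // opprK.
rewrite mxtrace_exp sq_sum [RHS]big_mkcond; apply: eq_bigr => s _ /=.
have -> : cycle_prod (fun i j => (diag_mx (\row_i 'X_i) *m map_mx (@mpolyC n _) A) i j) s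
  = cycle_prod (fun i j => A i j) s *: 'X_[\sum_(z <- s) U_(z)].
  rewrite -mul_mpolyC mulrC -rmorph_cycle_prod -mprodXE -cycle_prodM.
  by apply: eq_cycle_prod => i j; rewrite mul_diag_mx !mxE.
by rewrite sqZX squarefree_sum_seq.
Qed.
End SqLogDet.

(** * The traversals of a simple cycle *)

Section SimpleCycles.
Local Open Scope nat_scope.
Variable V : finType.
Implicit Types (s t : seq V) (x y : V).

Definition cycle_edges s : {set {set V}} := [set [set x; path.next s x] | x in s].

(** Rotation preserves successors, so a chosen vertex may be moved to the head, where [path.next]
    computes. *)
Lemma rot_cons2 s x : uniq s -> 1 < size s -> x \in s ->
  exists a t, [/\ uniq [:: x, a & t], perm_eq s [:: x, a & t]
                & path.next s =1 path.next [:: x, a & t]].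
Proof.
move=> us ss xs; case: (rot_to xs) => i q eq_rot.
case: q eq_rot => [|a t] eq_rot.
  by have := size_rot i s; rewrite eq_rot /= => e; rewrite -e in ss.
exists a, t; rewrite -eq_rot rot_uniq perm_sym perm_rot; split=> // z.
by rewrite next_rot.
Qed.

(** On two vertices [path.next] is an involution; from three on, two steps never lead back. This is
    what separates k >= 3 from k = 2: it makes distinct steps run along distinct edges and the two
    directions differ. *)
Lemma next_next_neq s x : uniq s -> 2 < size s -> x \in s ->
  path.next s (path.next s x) != x.
Proof.
move=> us ss xs; have [a [t [+ /perm_size st eq_next]]] := rot_cons2 us (ltnW ss) xs.
rewrite !eq_next; case: t st {eq_next} => [st|b t _]; first by rewrite st in ss.
rewrite /= !inE eqxx !negb_or eq_sym => /andP[/and3P[/negPf-> xb _] _].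
by rewrite eqxx eq_sym.
Qed.

Lemma next_neq_prev s x : uniq s -> 2 < size s -> x \in s ->
  path.next s x != prev s x.
Proof.
move=> us ss xs; apply/eqP => e.
have := next_next_neq us ss (etrans (mem_prev s x) xs).
by rewrite next_prev // e eqxx.
Qed.

Lemma set2_inj x y x' y' : [set x; y] = [set x'; y'] ->
  x = x' /\ y = y' \/ x = y' /\ y = x'.
Proof.
move=> e; have /set2P xE : x \in [set x'; y'] by rewrite -e set21.
have /set2P yE : y \in [set x'; y'] by rewrite -e set22.
have /set2P x'E : x' \in [set x; y] by rewrite e set21.
have /set2P y'E : y' \in [set x; y] by rewrite e set22.
by move: xE yE x'E y'E => [] ? [] ? [] ? [] ?; subst; auto.
Qed.

Lemma cycle_edge_inj s : uniq s -> 2 < size s ->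
  {in s &, injective (fun x => [set x; path.next s x])}.
Proof.
move=> us ss x y xs ys /set2_inj[[]//|[xy yx]].
by have := next_next_neq us ss xs; rewrite yx -xy eqxx.
Qed.

Lemma mem_cover_cycle_edges s x : (x \in cover (cycle_edges s)) = (x \in s).
Proof.
apply/bigcupP/idP => [[_ /imsetP[y ys ->]]|xs].
  by rewrite !inE => /orP[] /eqP -> //; rewrite mem_next.
by exists [set x; path.next s x]; [apply: imset_f | rewrite !inE eqxx].
Qed.

Lemma cycle_edges_rot i s : uniq s -> cycle_edges (rot i s) = cycle_edges s.
Proof.
move=> us; apply/setP => e; apply/imsetP/imsetP => -[x xs ->]; exists x;
  by rewrite ?next_rot // ?mem_rot // -(mem_rot i).
Qed.

Lemma cycle_edges_rev s : uniq s -> cycle_edges (rev s) = cycle_edges s.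
Proof.
move=> us; apply/setP => e; apply/imsetP/imsetP => -[x xs ->].
  exists (prev s x); first by rewrite mem_prev -mem_rev.
  by rewrite next_rev // next_prev // setUC.
exists (path.next s x); first by rewrite mem_rev mem_next.
by rewrite next_rev // prev_next // setUC.
Qed.

Section SameEdges.
Variables s t : seq V.
Hypotheses (us : uniq s) (ut : uniq t) (ss : 2 < size s)
  (st : cycle_edges s = cycle_edges t).

Lemma same_vertices : s =i t.
Proof. by move=> x; rewrite -!mem_cover_cycle_edges st. Qed.

Lemma same_size : size s = size t.
Proof. exact/perm_size/(uniq_perm us ut)/same_vertices. Qed.

Lemma next_same_edges x : x \in t ->
  path.next t x = path.next s x \/ path.next t x = prev s x.
Proof.
move=> xt; have : [set x; path.next t x] \in cycle_edges s by rewrite st; apply: imset_f.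
case/imsetP => y ys /set2_inj[[-> ->]|[xy ->]]; first by left.
by right; rewrite xy prev_next.
Qed.

(** Agreement of the directions at one vertex propagates: turning round at the next vertex would
    lead [t] straight back, against [next_next_neq]. Hence both sequences are rotations of the orbit
    of [x] under [path.next s]. *)
Lemma rot_same_edges x : x \in t -> path.next t x = path.next s x ->
  exists i, t = rot i s.
Proof.
move=> xt nx.
have iter_next k : iter k (path.next t) x \in t /\
    path.next t (iter k (path.next t) x) = path.next s (iter k (path.next t) x).
  elim: k => [|k [IHt IHn]] //=; set y := iter k _ x in IHt IHn *.
  have yt : path.next t y \in t by rewrite mem_next.
  split=> //; case: (next_same_edges yt) => //.
  rewrite IHn prev_next // => e.
  have := next_next_neq ut _ IHt; rewrite IHn e eqxx -same_size.
  by move/(_ ss).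
have next_st : {in t, path.next t =1 path.next s}.
  move=> y yt; have : fconnect (path.next t) x y.
    by rewrite (fconnect_cycle (cycle_next ut)).
  by move/iter_findex <-; case: (iter_next (findex (path.next t) x y)).
have ct : fcycle (path.next s) t.
  by apply: cycle_from_next => // y yt; rewrite /= next_st.
have xs : x \in s by rewrite same_vertices.
have [i ei] := orbit_rot_cycle (cycle_next us) us xs.
have [j ej] := orbit_rot_cycle ct ut xt.
(* The rotation by [size t - j] undoes the one by [j]. *)
exists (rot_add s i (size t - j)); rewrite -rot_rot_add -ei ej.
by have := rotK j t; rewrite /rotr size_rot.
Qed.
End SameEdges.

(** At a vertex of [t], the successor in [t] is either the successor or the predecessor in [s]; the
    second case is the first one for [rev s]. *)
Lemma same_edgesP s t : uniq s -> uniq t -> 2 < size s ->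
  cycle_edges s = cycle_edges t <-> exists i b, t = rot i (if b then rev s else s).
Proof.
move=> us ut ss; split=> [st|[i [b ->]]]; last first.
  by case: b; rewrite cycle_edges_rot ?rev_uniq // cycle_edges_rev.
case et: t => [|x t']; first by move: ss; rewrite (same_size us ut st) et.
rewrite -et; have xt : x \in t by rewrite et mem_head.
case: (next_same_edges us st xt) => nx.
  by have [i ei] := rot_same_edges us ut ss st xt nx; exists i, false.
have [|||i ei] := rot_same_edges _ ut _ (etrans (cycle_edges_rev us) st) xt.
- by rewrite rev_uniq.
- by rewrite size_rev.
- by rewrite next_rev.
by exists i, true.
Qed.

Lemma rot_index_inj s i j : uniq s -> i < size s -> j < size s ->
  rot i s = rot j s -> i = j.
Proof.
case: s => // x s us is_ js.
move/(congr1 (nth x ^~ 0)); rewrite /rot !nth_cat !size_drop !subn_gt0 is_ js.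
by rewrite !nth_drop !addn0 => /eqP; rewrite nth_uniq // => /eqP.
Qed.

Lemma card_same_edges k (s : k.-tuple V) : uniq s -> 2 < k ->
  #|[set t : k.-tuple V | uniq t & cycle_edges t == cycle_edges s]| = k * 2.
Proof.
move=> us k2; have ss : 2 < size s by rewrite size_tuple.
pose g (p : 'I_k * bool) := [tuple of rot p.1 (if p.2 then rev_tuple s else s)].
have gE p : val (g p) = rot p.1 (if p.2 then rev s else s) by rewrite /= ; case: (p.2).
have ub b : uniq (if b then rev s else s : seq V) by case: b; rewrite ?rev_uniq.
have -> : [set t : k.-tuple V | uniq t & cycle_edges t == cycle_edges s] = g @: setT.
  apply/setP => t; rewrite inE; apply/andP/imsetP => [[ut /eqP/esym/same_edgesP[]//]|].
    move=> i [b tE]; have k0 : 0 < k by apply: ltnW (ltnW k2).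
    case: (ltnP i k) => [ik|ki].
      by exists (Ordinal ik, b) => //; apply: val_inj; rewrite gE.
    (* A rotation by at least the length is the identity, hence the index 0. *)
    exists (Ordinal k0, b) => //; apply: val_inj; rewrite gE /= tE rot0 rot_oversize //.
    by case: b {tE}; rewrite ?size_rev size_tuple.
  move=> [p _ ->]; rewrite gE rot_uniq; split=> //; apply/eqP/esym/same_edgesP => //.
    by rewrite rot_uniq.
  by exists p.1, p.2.
rewrite card_imset ?cardsT ?card_prod ?card_ord ?card_bool // => -[i b] [j c].
move=> /(congr1 val); rewrite !gE /= => e.
have [x xs] : exists x, x \in s.
  by exists (tnth s (Ordinal (ltnW (ltnW k2)))); apply: mem_tnth.
(* The successor of a single vertex tells the directions apart: rotation preserves it, and reversal
   turns it into the predecessor. *)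
have bc : b = c.
  have := congr1 (fun u => path.next u x) e; rewrite /= !next_rot //.
  have := next_neq_prev us ss xs.
  by case: b c {e} => [] [] // /eqP nx; rewrite next_rev // => e; case: nx.
congr (_, _) => //; apply: val_inj; rewrite -{c}bc in e.
by apply: (rot_index_inj (ub b)) e; case: b; rewrite ?size_rev size_tuple /=.
Qed.
End SimpleCycles.

(** * Weighted simple graphs *)

Lemma cycle_nextE (T : eqType) (e : rel T) (s : seq T) : uniq s ->
  cycle e s = all (fun x => e x (path.next s x)) s.
Proof.
by move=> us; apply/idP/allP => [cs x|]; [apply: next_cycle | apply: cycle_from_next].
Qed.

Lemma reindex_tuple (R : nmodType) (S T : finType) (h : S -> T) (k : nat)
    (F : k.-tuple T -> R) : bijective h ->
  \sum_t F t = \sum_s F (map_tuple h s).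
Proof.
case=> g hK gK; apply: reindex; exists (map_tuple g) => s _;
  by apply: val_inj; rewrite /= -map_comp -[RHS]map_id; apply: eq_map.
Qed.

Lemma wrpoly_mulIn (k : nat) (P Q : wrpoly) : (0 < k)%N -> P *+ k = Q *+ k -> P = Q.
Proof.
move=> k0 e; apply/mpolyP => m; apply: (pmulrnI k0).
by rewrite -!mcoeffMn e.
Qed.

Section Graph.
Variable G : graph.
Local Notation V := (vertex G).
Local Notation E := (fun x y : V => [set x; y] \in edges G).
Hypothesis edges2 : forall e, e \in edges G -> #|e| = 2%N.

Lemma sq_log_det_cycles (k : nat) : (0 < k)%N ->
  sq_log_det (adjacency G) k *+ k =
  \sum_(s : k.-tuple V | ucycleb E s) \prod_(x <- s) wg [set x; path.next s x].
Proof.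
move=> k0; rewrite sq_log_det_tuples // big_mkcond [RHS]big_mkcond.
rewrite [RHS](reindex_tuple _ (@enum_val_bij V)); apply: eq_bigr => s _ /=.
rewrite /ucycleb (map_inj_uniq enum_val_inj) andbC.
case us: (uniq s) => //=; rewrite cycle_nextE ?map_inj_uniq //; try exact: enum_val_inj.
rewrite cycle_prod_next // all_map big_map.
rewrite (@eq_all _ _ (fun i => [set enum_val i; enum_val (path.next s i)] \in edges G));
  last by move=> i /=; rewrite next_map //; apply: enum_val_inj.
rewrite [in RHS](eq_bigr (fun i => wg [set enum_val i; enum_val (path.next s i)]));
  last by move=> i _; rewrite next_map //; apply: enum_val_inj.
case: allP => [sE|Ns].
  by apply: eq_big_seq => i /sE; rewrite mxE /= => ->.
(* A step along a non-edge meets a zero entry of the matrix, which annihilates the product. *)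
have /allPn[i si /negPf iE] : ~~ all (fun i =>
    [set enum_val i; enum_val (path.next s i)] \in edges G) s.
  by apply/allP.
by rewrite big_uniq // (bigD1 i) //= mxE /= iE mul0r.
Qed.

Lemma ucycle_edges (s : seq V) :
  ucycleb E s = uniq s && (cycle_edges s \subset edges G).
Proof.
rewrite /ucycleb andbC; case us: (uniq s) => //=; rewrite cycle_nextE //.
apply/allP/subsetP => [sE _ /imsetP[x xs ->]|sE x xs]; first exact: sE.
exact/sE/imset_f.
Qed.

(** The closed walks are grouped by their edge sets. All walks in a group have the weight of the
    cycle, and [card_same_edges] counts [k * 2] of them, of which the factor [k] cancels. *)
Lemma sq_log_det_cycle_poly (k : nat) : (2 < k)%N ->
  sq_log_det (adjacency G) k = cycle_poly G k *+ 2.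
Proof.
move=> k2; have k0 : (0 < k)%N by apply: ltnW (ltnW k2).
apply: (wrpoly_mulIn k0); rewrite sq_log_det_cycles // -mulrnA /cycle_poly.
rewrite ifN ?gtn_eqF //.
rewrite (partition_big (fun s : k.-tuple V => cycle_edges s) (@is_cycle G k)); last first.
  by move=> s us; apply/existsP; exists s; rewrite us /=.
rewrite -sumrMnl; apply: eq_bigr => C /existsP[s /andP[cs /eqP eC]].
have us : uniq s by case/andP: cs.
transitivity (\sum_(t : k.-tuple V | uniq t && (cycle_edges t == cycle_edges s))
  \prod_(e in C) wg e).
  apply: eq_big => [t|t /andP[/andP[ct ut]]]; rewrite eC.
    rewrite ucycle_edges -andbA; congr (_ && _).
    case: eqP => [->|]; last by rewrite andbF.
    by move: cs; rewrite ucycle_edges us /= => ->.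
  move=> /eqP <-; rewrite big_imset /=; last first.
    by apply: cycle_edge_inj; rewrite ?size_tuple.
  by rewrite big_uniq.
by rewrite sumr_const [(2 * k)%N]mulnC -(card_same_edges us k2) cardsE.
Qed.

Lemma sq_log_det_edges : sq_log_det (adjacency G) 2 = \sum_(e in edges G) wg e ^+ 2.
Proof.
apply: (@wrpoly_mulIn 2); rewrite ?sq_log_det_cycles // -sumrMnl.
have setE (x y : V) : [set z in [:: x; y]] = [set x; y] by apply/setP => z; rewrite !inE.
have tupleE (a b c d : V) : ([tuple a; b] == [tuple c; d]) = (a == c) && (b == d).
  by rewrite -val_eqE /= !eqseq_cons andbT.
(* For two vertices the vertex set of the walk is the edge itself; the walks over it are its two
   orderings. *)
rewrite (partition_big (fun s : 2.-tuple V => [set x in s])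
  (fun e => e \in edges G)) /=; last first.
  case/tupleP=> x s; case/tupleP: s => y s; rewrite (tuple0 s) /ucycleb /=.
  by rewrite setE => /andP[/andP[]].
apply: eq_bigr => e eE; have /eqP/cards2P[x [y [xy eqe]]] := edges2 eE.
transitivity (\sum_(t in [set [tuple x; y]; [tuple y; x]]) wg e ^+ 2); last first.
  by rewrite sumr_const cards2 tupleE (negPf xy).
apply: eq_big => [t|t].
  case/tupleP: t => a s; case/tupleP: s => b s; rewrite (tuple0 s) in_set2 !tupleE.
  rewrite setE /ucycleb /= !andbT inE.
  apply/idP/idP => [/andP[_ /eqP]|].
    by rewrite eqe => /set2_inj[] [-> ->]; rewrite !eqxx ?orbT.
  by case/orP=> /andP[/eqP-> /eqP->];
    rewrite ?[[set y; x]]setUC -eqe eE eqxx ?[y == x]eq_sym xy.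
case/tupleP: t => a s; case/tupleP: s => b s; rewrite (tuple0 s) /ucycleb /= setE.
rewrite inE => /andP[/andP[_ /andP[/negPf ab _]] /eqP <-].
by rewrite !big_cons big_nil /= !eqxx eq_sym ab mulr1 [[set b; a]]setUC expr2.
Qed.

Lemma ucycle_size_le (k : nat) (s : k.-tuple V) : ucycleb E s -> (k <= #|V|)%N.
Proof. by case/andP => _ us; rewrite -(size_tuple s) -(card_uniqP us) max_card. Qed.

Lemma sq_log_det_gt (k : nat) : (#|V| < k)%N -> sq_log_det (adjacency G) k = 0.
Proof.
move=> Vk; have k0 : (0 < k)%N by apply: leq_trans Vk.
apply: (wrpoly_mulIn k0); rewrite sq_log_det_cycles // mul0rn big_pred0 // => s.
by apply/negP => /ucycle_size_le; rewrite leqNgt Vk.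
Qed.

Lemma cycle_poly_gt (k : nat) : (2 <= k)%N -> (#|V| < k)%N -> cycle_poly G k = 0.
Proof.
rewrite /cycle_poly => k2 Vk; case: eqP => [k_2|_].
  (* [cycle_poly] sums over edges for [k = 2], so the bound comes from the two ends of an edge
     instead of the length of a cycle. *)
  rewrite big_pred0 // => e; apply/negP => /edges2 e2.
  have : (#|V| < #|e|)%N by rewrite e2 -k_2.
  by rewrite ltnNge max_card.
rewrite big_pred0 // => C; apply/existsP => -[s /andP[/ucycle_size_le]].
by rewrite leqNgt Vk.
Qed.
End Graph.

(** * Tait graphs *)

Lemma in_squares_prod (m : 'X_{1..2}) :
  \prod_(i < 2) tnth [tuple w ^+ 2; r ^+ 2] i ^+ m i = 'X_[m *+ 2].
Proof.
rewrite -mpolyXn [in RHS]mpolyXE_id -prodrXl; apply: eq_bigr => i _.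
rewrite -exprM mulnC exprM; congr (_ ^+ _).
by case: i => [[|[|//]] i2]; rewrite (tnth_nth 0) /=; congr ('X_ _ ^+ 2); apply: val_inj.
Qed.

(** Doubling exponents is injective, so no two monomials of [P] are merged. Thus the substitution of
    w for w^2 and r for r^2 is well defined. *)
Lemma in_squares_coef (P : wrpoly) (m : 'X_{1..2}) : (in_squares P)@_(m *+ 2) = P@_m.
Proof.
rewrite /in_squares comp_mpolyE [in RHS](mpolyE P) !raddf_sum /=.
apply: eq_bigr => m' _; rewrite in_squares_prod !mcoeffZ !mcoeffX; congr (_ * _%:R).
congr nat_of_bool; apply/eqP/eqP => [/mnmP e|-> //]; apply/mnmP => i.
by have := e i; rewrite !mulmnE => /eqP; rewrite eqn_pmul2r // => /eqP.
Qed.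

Lemma in_squares_inj : injective in_squares.
Proof.
by move=> P Q e; apply/mpolyP => m; rewrite -(in_squares_coef P) e in_squares_coef.
Qed.

(** An edge weight is a product of variables, so squaring the variables squares it. *)
Lemma in_squares_wg (D : diagram) (b : bool) (p : {set tait_vertex D b}) :
  in_squares (wg (g := consolidate (tait D b)) p) =
  wg (g := consolidate (tait D b)) p ^+ 2.
Proof.
rewrite /= /in_squares rmorph_prod -prodrXl; apply: eq_bigr => c _ /=.
by case: ifP => _; rewrite comp_mpolyXU.
Qed.

Lemma in_squares_cycle_poly2 (D : diagram) (b : bool) :
  in_squares (cycle_poly (consolidate (tait D b)) 2) =
  \sum_(e in edges (consolidate (tait D b))) wg e ^+ 2.
Proof.
rewrite /cycle_poly eqxx /in_squares raddf_sum; apply: eq_bigr => e _.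
exact: in_squares_wg.
Qed.

Lemma step_backK (T : Type) : cancel (@step_back T) (@step T).
Proof. by case=> c i; rewrite /step /= ord_predK. Qed.

Lemma next_inj (D : diagram) : injective (@Defs.next D).
Proof. exact: inj_comp (can_inj (@step_backK _)) (inv_inj (@oppK D)). Qed.

Lemma fconnect_next_sym (D : diagram) : connect_sym (frel (@Defs.next D)).
Proof. exact/fconnect_sym/next_inj. Qed.

(** The corners of colour [b] at a crossing are the opposite ones numbered [b] and [b + 2], with [b]
    read as 0 or 1. They lie in different regions because the crossing is not nugatory. *)
Lemma tait_edge_card (D : diagram) (b : bool) e : alternating D -> reduced D ->
  e \in edges (consolidate (tait D b)) -> #|e| = 2%N.
Proof.
move=> altD redD /imsetP[c _ ->] {e}.
pose reg (i : 'I_4) : {set corner D} := [set x in orbit (@Defs.next D) (c, i)].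
pose i0 : 'I_4 := inord b; pose i1 : 'I_4 := inord (b + 2).
have i0E : i0 = b :> nat by rewrite inordK //; case: (b).
have i1E : i1 = (b + 2)%N :> nat by rewrite inordK //; case: (b).
have cr (i : 'I_4) : odd i == b -> coloured b (reg i) by move=> ib; rewrite colouredP.
have c0 : coloured b (reg i0) by apply: cr; rewrite i0E; case: (b).
have c1 : coloured b (reg i1) by apply: cr; rewrite i1E; case: (b).
pose v0 : tait_vertex D b := inl (Sub (reg i0) c0).
pose v1 : tait_vertex D b := inl (Sub (reg i1) c1).
have -> : mends (m := tait D b) c = [set v0; v1].
  apply/setP => -[[R cR]|j]; rewrite !inE //=.
  have vE i (ci : coloured b (reg i)) :
    (inl (exist _ R cR) == inl (Sub (reg i) ci) :> tait_vertex D b) = (R == reg i).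
    by rewrite (inj_eq inl_inj) -val_eqE.
  rewrite !vE; apply/existsP/orP => /= [[i iR]|[]/eqP->]; last 2 first.
  - by exists i0; rewrite inE -fconnect_orbit connect0.
  - by exists i1; rewrite inE -fconnect_orbit connect0.
  have /andP[/existsP[d /eqP Rd] /forall_inP/(_ _ iR) /= oddi] := cR.
  have -> : R = reg i.
    apply/setP => x; move: iR; rewrite Rd !inE -!fconnect_orbit => di.
    exact: same_connect (@fconnect_next_sym D) _ _ di x.
  have /orP[] : (i == i0) || (i == i1); last 2 first.
  - by move=> /eqP->; left.
  - by move=> /eqP->; right.
  rewrite -!val_eqE /= i0E i1E; move: oddi; case: (b);
    by case: i {iR} => [[|[|[|[|]]]]].
rewrite cards2 (inj_eq inl_inj) -val_eqE.
suff -> : reg i0 != reg i1 by [].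
apply/eqP => /setP /(_ (c, i1)); rewrite !inE -!fconnect_orbit connect0 => i01.
case: (redD c); exists i0; rewrite (_ : straight _ = (c, i1)) //.
congr (_, _); apply: val_inj => /=; rewrite i0E i1E; by case: (b).
Qed.

Lemma omit_trailing_nseq (T : eqType) (z : T) (s : seq T) (m : nat) :
  omit_trailing z (s ++ nseq m z) = omit_trailing z s.
Proof.
rewrite /omit_trailing rev_cat rev_nseq find_cat has_nseq /= eqxx andbF.
by rewrite addnC -drop_drop drop_size_cat.
Qed.

Section TaitGraph.
Variables (D : diagram).
Hypotheses (altD : alternating D) (redD : reduced D).

Lemma cycle_poly_tait (b : bool) (k : nat) : (2 < k)%N ->
  cycle_poly (consolidate (tait D b)) k =
  (2%:R^-1 : rat) *: sq_log_det (adjacency (consolidate (tait D b))) k.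
Proof.
move=> k2; rewrite sq_log_det_cycle_poly //.
by rewrite -(@scaler_nat rat) scalerA mulVf // scale1r.
Qed.

Lemma in_squares_tait (b : bool) :
  sq_log_det (adjacency (consolidate (tait D b))) 2 =
  in_squares (cycle_poly (consolidate (tait D b)) 2).
Proof.
rewrite in_squares_cycle_poly2 sq_log_det_edges // => e; exact: tait_edge_card.
Qed.

Lemma sq_log_det_poly (b : bool) : exists P : {poly wrpoly},
  forall k, sq_log_det (adjacency (consolidate (tait D b))) k = P`_k.
Proof.
set G := consolidate _.
exists (\poly_(k < #|vertex G|.+1) sq_log_det (adjacency G) k) => k.
by rewrite coef_poly ltnS; case: leqP => // /sq_log_det_gt.
Qed.

(** Diagrams with different numbers of regions give lists of different lengths. Padding with pairs
    (0, 0), the values beyond the number of vertices, allows a comparison over a common range. *)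
Lemma CWR_widen (rule : bool) (m : nat) :
  CWR rule D = omit_trailing (0, 0) [seq CWR_coef rule D i
    | i <- iota 2 (#|vertex (GB rule D)| + #|vertex (GW rule D)| + m)].
Proof.
rewrite /CWR; set N := (_ + #|_|)%N.
have -> : [seq CWR_coef rule D i | i <- iota 2 (N + m)] =
    [seq CWR_coef rule D i | i <- iota 2 N] ++ nseq m (0, 0).
  rewrite iotaD map_cat; congr (_ ++ _).
  have /all_pred1P : all (pred1 (0, 0)) [seq CWR_coef rule D i | i <- iota (2 + N) m].
    rewrite all_map; apply/allP => i; rewrite mem_iota => /andP[Ni _] /=.
    rewrite xpair_eqE; apply/andP; split; apply/eqP/cycle_poly_gt.
    - by move=> e; apply: tait_edge_card.
    - exact: leq_trans (leq_addr _ _) Ni.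
    - by apply: leq_trans Ni; rewrite ltnS leqW ?leq_addr.
    - by move=> e; apply: tait_edge_card.
    - exact: leq_trans (leq_addr _ _) Ni.
    - by apply: leq_trans Ni; rewrite ltnS leqW ?leq_addl.
  by rewrite size_map size_iota.
by rewrite omit_trailing_nseq.
Qed.
End TaitGraph.

Theorem corollary4p5 (rule : bool) (L : link) (D : diagram)
    (nsL : nonsplit L) (altL : alternating_link L)
    (DL : reduced_alternating_diagram L D) :
  [/\ (* the formula for CWR_k(L) *)
      forall k : nat, (3 <= k)%N ->
        CWR_coef rule D k = (2%:R^-1 : rat) *: (sqB rule D k, sqW rule D k),
      (* both power series are polynomials in t *)
      exists PB PW : {poly wrpoly},
        forall k : nat, sqB rule D k = PB`_k /\ sqW rule D k = PW`_k,
      (* CWR_2(L) is obtained from the coefficients of t^2, which are polynomials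
         in w^2 and r^2, by replacing w^2 by w and r^2 by r *)
      (exists P Q : wrpoly,
         sqB rule D 2 = in_squares P /\ sqW rule D 2 = in_squares Q) /\
      (forall P Q : wrpoly,
         sqB rule D 2 = in_squares P -> sqW rule D 2 = in_squares Q ->
         CWR_coef rule D 2 = (P, Q))
    & (* the pair of polynomials determines CWR(L) *)
      forall (L' : link) (D' : diagram),
        nonsplit L' -> alternating_link L' ->
        reduced_alternating_diagram L' D' ->
        (forall k : nat, sqB rule D k = sqB rule D' k) ->
        (forall k : nat, sqW rule D k = sqW rule D' k) ->
        CWR rule D = CWR rule D'].
Proof.
case: DL => _ redD altD; split.
- by move=> k k3; congr (_, _); apply: cycle_poly_tait.
- have [PB PBE] := sq_log_det_poly D rule; have [PW PWE] := sq_log_det_poly D (~~ rule).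
  by exists PB, PW => k; rewrite -PBE -PWE.
- split=> [|P Q].
    exists (cycle_poly (GB rule D) 2), (cycle_poly (GW rule D) 2).
    by split; apply: in_squares_tait.
  rewrite /sqB /sqW !in_squares_tait // => /in_squares_inj <- /in_squares_inj <- //.
move=> L' D' _ _ [_ redD' altD'] eB eW.
(* Each list is widened by the length of the other. *)
rewrite (CWR_widen altD redD rule (#|vertex (GB rule D')| + #|vertex (GW rule D')|)).
rewrite (CWR_widen altD' redD' rule (#|vertex (GB rule D)| + #|vertex (GW rule D)|)).
rewrite addnC; congr omit_trailing; apply/eq_in_map => i.
rewrite mem_iota => /andP[i2 _]; congr (_, _).
  move: i2; rewrite leq_eqVlt => /predU1P[<-|i3].
    (* For [i = 2] the comparison takes place after the injective substitution of squares, which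
       yields the coefficient of t^2. *)
    by apply: in_squares_inj; rewrite -!in_squares_tait //; apply: eB.
  by rewrite /GB !cycle_poly_tait //; congr (_ *: _); apply: eB.
move: i2; rewrite leq_eqVlt => /predU1P[<-|i3].
  by apply: in_squares_inj; rewrite -!in_squares_tait //; apply: eW.
by rewrite /GW !cycle_poly_tait //; congr (_ *: _); apply: eW.
Qed.
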